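(* Let $f:[0,\infty)\to[0,\infty)$ be integrable and ultimately nonincreasing, and let $T^n(f)$ denote the $n$-fold iterated tail integral of $f$. For each integer $n\ge1$, if (6.1a) $T^{n}(f)(x)\sim b\,x^{\kappa}e^{-\alpha x}$ as $x\to\infty$ for some real number $\kappa$, positive number $b$ and nonnegative number $\alpha$, then $f(x)\sim\alpha^{n}b\,x^{\kappa}e^{-\alpha x}$ as $x\to\infty$. In particular, (6.1a) implies that $T(f)(x)\sim\alpha^{n-1}b\,x^{\kappa}e^{-\alpha x}$ as $x\to\infty$ for any nonnegative and integrable function $f$ on $[0,\infty)$ (not necessarily ultimately nonincreasing).
   Context: $f$ is ultimately nonincreasing if there is $x_0$ such that $f(x)$ is nonincreasing for $x\ge x_0$. $T^0(f)=f$, $T^{n}(f)(x)=\int_x^\infty T^{n-1}(f)(u)\,du$ for $x>0$, $n\ge1$, and $T=T^1$. For functions $f_1,f_2$ on $[0,\infty)$, $f_1(x)\sim f_2(x)$ as $x\to\infty$ means $\lim_{x\to\infty}f_1(x)/f_2(x)=1$.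
   Formalization: When the constant factor (α^n b or α^{n-1} b) is 0, which happens only for α = 0, the quotient defining ∼ is undefined; the conclusion is then read as f(x)/(x^κ e^{-αx}) → 0 (respectively T(f)(x)/(x^κ e^{-αx}) → 0). *)

(* Defs.v *)
From HB Require Import structures.
From mathcomp Require Import all_boot all_order all_algebra.
From mathcomp Require Import all_classical all_reals all_analysis.
Set Implicit Arguments.
Unset Strict Implicit.
Unset Printing Implicit Defensive.
Import Order.TTheory GRing.Theory Num.Theory.
Import numFieldNormedType.Exports.
Local Open Scope classical_set_scope.
Local Open Scope ring_scope.

(* Functions on [0, +oo[ are represented by functions on R whose values at
   negative arguments are irrelevant. *)

Definition ultimately_nonincreasing (R : realType) (f : R -> R) : Prop :=
  exists2 x0 : R, 0 <= x0 & forall x y : R, x0 <= x -> x <= y -> f y <= f x.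

(* Values are extended reals because an iterated tail integral of an integrable
   function may be infinite. *)
Definition tail_integral (R : realType) (g : R -> \bar R) (x : R) : \bar R :=
  (\int[@lebesgue_measure R]_(u in `]x, +oo[) g u)%E.

Definition iter_tail (R : realType) (n : nat) (f : R -> R) : R -> \bar R :=
  iter n (@tail_integral R) (EFin \o f).

Definition asymp_equiv (R : realType) (F : R -> \bar R) (g : R -> R) : Prop :=
  (F x * ((g x)^-1)%:E)%E @[x --> +oo] --> 1%:E.

(* F(x) ~ c g(x).  When c = 0 the quotient F / (c g) is undefined, and the
   relation has its usual meaning F(x) = o(g(x)). *)
Definition asymp_equiv_scale (R : realType)
    (F : R -> \bar R) (c : R) (g : R -> R) : Prop :=
  if c == 0 then (F x * ((g x)^-1)%:E)%E @[x --> +oo] --> 0%:E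
  else asymp_equiv F (fun x => c * g x).

(* Main.v *)
Require Import Defs.
From HB Require Import structures.
From mathcomp Require Import all_boot all_order all_algebra.
From mathcomp Require Import ring lra.
From mathcomp Require Import all_classical all_reals all_analysis.
From mathcomp Require Import measurable_realfun.
Set Implicit Arguments.
Unset Strict Implicit.
Unset Printing Implicit Defensive.
Import Order.TTheory GRing.Theory Num.Theory.
Import numFieldNormedType.Exports.
Local Open Scope classical_set_scope.
Local Open Scope ring_scope.

(* For g nonincreasing with tail integral G and for t > 0,
   t g(x + t) <= G(x) - G(x + t) <= t g(x).  If G ~ c h with
   h(x + t) / h(x) --> exp(- alpha t) for every t, dividing by t h pins the
   limit points of g / h between c (1 - exp(- alpha t)) / t and
   c (exp(alpha t) - 1) / t, and letting t tend to 0 gives g / h --> alpha c.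
   Every tail integral is nonincreasing, so this step descends from T^n f to
   T f, and once more to f when f itself is ultimately nonincreasing.  Working
   with limits of quotients by h allows c = 0, which occurs when alpha = 0. *)

(** * Behaviour of x^kappa exp(- alpha x) under shifts *)

Lemma cvg_addr_pinfty (R : realType) (t : R) : x + t @[x --> +oo] --> +oo.
Proof.
apply/cvgryPge => A; near=> x.
by rewrite -lerBlDr; near: x; exact: nbhs_pinfty_ge (num_real _).
Unshelve. all: by end_near. Qed.

(** Writing x + t = x (1 + t / x) turns the quotient of the powers into (1 + t / x)^kappa, which
    tends to 1; only the exponential factor survives. *)
Lemma cvg_shift_ratio (R : realType) (kappa alpha t : R) :
  ((x + t) `^ kappa * expR (- alpha * (x + t))) /
    (x `^ kappa * expR (- alpha * x)) @[x --> +oo] --> expR (- alpha * t).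
Proof.
have inv0 : (x : R)^-1 @[x --> +oo] --> (0 : R).
  by apply/gtr0_cvgV0 => //; exact: nbhs_pinfty_gt (num_real _).
have one_cvg : 1 + t * x^-1 @[x --> +oo] --> (1 : R).
  rewrite -[X in _ --> X]addr0 -[X in _ --> _ + X](mulr0 t).
  by apply: cvgD; [exact: cvg_cst|apply: cvgM; [exact: cvg_cst|]].
have pow_cvg : (1 + t * x^-1) `^ kappa @[x --> +oo] --> (1 : R).
  have : (1 + t * x^-1) `^ kappa @[x --> +oo] --> (1 : R) `^ kappa.
    apply: (@continuous_cvg _ _ _ _ _ _ (fun y : R => y `^ kappa)) => //.
    apply/differentiable_continuous/derivable1_diffP/derivable_powR.
    by rewrite in_itv/= ltr01.
  by rewrite powR1.
rewrite -[X in _ --> X]mul1r.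
have : (1 + t * x^-1) `^ kappa * expR (- alpha * t) @[x --> +oo] -->
   1 * expR (- alpha * t) by apply: cvgM; [exact: pow_cvg|exact: cvg_cst].
apply: cvg_trans; apply: near_eq_cvg; near=> x.
have x0 : 0 < x by near: x; exact: nbhs_pinfty_gt (num_real _).
have xt0 : 0 <= 1 + t * x^-1.
  near: x.
  move/cvgr_gt : one_cvg => /(_ 0 ltr01); apply: filterS => x; exact: ltW.
have -> : x + t = x * (1 + t * x^-1) by field; rewrite gt_eqF.
rewrite powRM ?(ltW x0)//.
have -> : - alpha * (x * (1 + t / x)) = - alpha * x + - alpha * t.
  by field; rewrite gt_eqF.
rewrite expRD; field.
by rewrite !gt_eqF ?expR_gt0 ?powR_gt0.
Unshelve. all: by end_near. Qed.

(** This is - c times the derivative of exp(- alpha t) at 0. The sign convention lets one expression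
    serve for both bounds on g / h: the lower one for t > 0, the upper one for t < 0. *)
Lemma cvg_expR_difference_quotient (R : realType) (c alpha : R) :
  c * (expR (- alpha * t) - 1) / (- t) @[t --> 0^'] --> alpha * c.
Proof.
have d : is_derive (0 : R) 1 (expR \o *%R (- alpha)) (- alpha).
  have lin : is_derive (0 : R) 1 ( *%R (- alpha)) (- alpha).
    rewrite -[X in is_derive _ _ _ X]mulr1.
    exact: (@is_deriveZ R R R id (- alpha) 0 1 1).
  have := @is_derive1_comp R expR ( *%R (- alpha)) 0 _ _
    (is_derive_expR _) lin.
  by rewrite mulr0 expR0 mul1r.
case: d => + dE; rewrite /derivable /derive => dq.
rewrite /derive in dE.
pose q (h : R) := h^-1 *: (((expR \o *%R (- alpha)) \o shift 0) (h *: (1 : R))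
  - (expR \o *%R (- alpha)) 0).
have {}dq : q h @[h --> 0^'] --> - alpha.
  by rewrite -[X in _ --> X]dE; exact: dq.
have -> : alpha * c = - c * - alpha by ring.
have : - c * q h @[h --> 0^'] --> - c * - alpha.
  by apply: cvgM; [exact: cvg_cst|exact: dq].
apply: cvg_trans; apply: near_eq_cvg; near=> h.
rewrite /q /= /GRing.scale/= mulr1 addr0 mulr0 expR0 invrN; ring.
Unshelve. all: by end_near. Qed.

(** * The monotone density argument for real functions *)

Lemma cvg_monotone_density (R : realType) (G g h : R -> R) (alpha c : R) :
  (\forall x \near +oo, 0 < h x) ->
  (forall t, h (x + t) / h x @[x --> +oo] --> expR (- alpha * t)) ->
  (\forall x \near +oo, forall t, 0 < t ->
     t * g (x + t) <= G x - G (x + t) <= t * g x) ->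
  G x / h x @[x --> +oo] --> c ->
  g x / h x @[x --> +oo] --> alpha * c.
Proof.
move=> h0 hr Gg Gh.
have quot t : t != 0 ->
    (G (x + t) - G x) / (- t) / h x @[x --> +oo] -->
    c * (expR (- alpha * t) - 1) / (- t).
  move=> t0.
  have -> : c * (expR (- alpha * t) - 1) = c * expR (- alpha * t) - c by ring.
  (* The factor h (x + t) / h x converts the limit of G / h along x + t into a limit relative to h
     x. *)
  have : (G (x + t) / h (x + t) * (h (x + t) / h x) - G x / h x) / (- t)
      @[x --> +oo] --> (c * expR (- alpha * t) - c) / (- t).
    apply: cvgM; last exact: cvg_cst.
    apply: cvgB => //; apply: cvgM; last exact: hr.
    exact: (cvg_comp (fun x => x + t) (fun x => G x / h x)
      (@cvg_addr_pinfty R t) Gh).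
  apply: cvg_trans; apply: near_eq_cvg; near=> x.
  have hx : 0 < h x by near: x.
  have hxt : 0 < h (x + t) by near: x; exact: (@cvg_addr_pinfty R t _ h0).
  by field; rewrite t0 !gt_eqF.
have pos t : 0 < t -> \forall x \near +oo,
    (G (x + t) - G x) / (- t) / h x <= g x / h x.
  move=> t0; near=> x.
  have hx : 0 < h x by near: x.
  rewrite ler_pM2r ?invr_gt0// invrN mulrN -mulNr opprB ler_pdivrMr// mulrC.
  have : t * g (x + t) <= G x - G (x + t) <= t * g x.
    by move: t t0; near: x.
  by case/andP.
(* For t < 0 the increment bounds are applied at the point x + t with increment - t, which ends at
   x. *)
have neg t : t < 0 -> \forall x \near +oo,
    g x / h x <= (G (x + t) - G x) / (- t) / h x.
  move=> t0; near=> x.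
  have hx : 0 < h x by near: x.
  rewrite ler_pM2r ?invr_gt0// ler_pdivlMr ?oppr_gt0// mulrC.
  have : - t * g (x + t - t) <= G (x + t) - G (x + t - t) <= - t * g (x + t).
    have : 0 < - t by rewrite oppr_gt0.
    (* Generalising the increment turns the goal into the property in [Gg] at x + t, which holds
       eventually because x + t tends to infinity. *)
    move: (- t).
    near: x; exact: (@cvg_addr_pinfty R t _ Gg).
  by rewrite addrK => /andP[].
have cq := @cvg_expR_difference_quotient R c alpha.
apply/cvgrPdist_lt => e e0.
have /cvgrPdist_lt/(_ _ e0) := cq.
case=> d /= d0 H.
(* The limit at 0 is two-sided, so one radius d serves both signs; the bounds are used at t = d / 2
   and t = - (d / 2). *)
have d20 : 0 < d / 2 by rewrite divr_gt0.
have m0 : - (d / 2) < 0 by rewrite oppr_lt0.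
have d2 : d / 2 < d by rewrite ltr_pdivrMr// ltr_pMr// ltr1n.
have Hp := H (d / 2); have Hn := H (- (d / 2)).
have nd : `|d / 2| = d / 2 by rewrite gtr0_norm.
rewrite /ball_/= sub0r normrN nd in Hp.
rewrite /ball_/= sub0r opprK nd in Hn.
have {}Hp := Hp d2 (lt0r_neq0 d20).
have {}Hn := Hn d2 (ltr0_neq0 m0).
rewrite !ltr_distl in Hp Hn.
case/andP: Hp => Hp1 Hp2; case/andP: Hn => Hn1 Hn2.
have Ep : \forall x \near +oo, alpha * c - e < g x / h x.
  have lb : alpha * c - e < c * (expR (- alpha * (d / 2)) - 1) / (- (d / 2)).
    by rewrite ltrBlDr.
  apply: filterS2 (cvgr_gt _ (quot _ (lt0r_neq0 d20)) _ lb) (pos _ d20).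
  by move=> x; exact: lt_le_trans.
have En : \forall x \near +oo, g x / h x < alpha * c + e.
  have ub : c * (expR (- alpha * (- (d / 2))) - 1) / (- (- (d / 2))) <
      alpha * c + e.
    by rewrite opprK -ltrBlDr.
  apply: filterS2 (cvgr_lt _ (quot _ (ltr0_neq0 m0)) _ ub) (neg _ m0).
  by move=> x lt1 le1; exact: le_lt_trans le1 lt1.
near=> x; rewrite distrC ltr_distl; apply/andP; split; near: x.
Unshelve. all: by end_near. Qed.

(** The preimage in D of a closed upper ray is again an interval, and such rays generate the
    measurable sets of the extended reals. *)
Lemma nonincreasing_emeasurable (R : realType) (D : set R) (f : R -> \bar R) :
  is_interval D ->
  (forall x y, D x -> D y -> x <= y -> (f y <= f x)%E) ->
  measurable_fun D f.
Proof.
move=> iD fD mD.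
apply: (measurability (@ErealGenCInfty.G R)) => //.
  exact: ErealGenCInfty.measurableE.
move=> /= _ [_ [r ->] <-]; apply: is_interval_measurable => s t /=.
rewrite /= !in_itv/= !andbT => -[Ds fs] [Dt ft] u sut.
have Du : D u by exact: (iD s t).
split => //; case/andP: sut => _ ut.
by rewrite in_itv/= andbT (le_trans ft)// fD.
Qed.

(** * Tail integrals of nonnegative measurable functions *)

Section tail_integral.
Context {R : realType}.
Implicit Types (g : R -> \bar R) (x y t : R).
Local Notation mu := (@lebesgue_measure R).

(** Unlike integrability, this property passes from g to its tail integral, even when that integral
    is infinite, so it can be carried through the iteration. *)
Definition nonneg_measurable g :=
  (forall x, 0 <= x -> (0 <= g x)%E) /\
  measurable_fun (`[0, +oo[%classic : set R) g.

Lemma tail_split g x y : nonneg_measurable g -> 0 <= x -> x <= y ->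
  tail_integral g x = (\int[mu]_(u in `]x, y]) g u + tail_integral g y)%E.
Proof.
move=> [g0 mg] x0 xy; rewrite /tail_integral -ge0_integral_setU//=.
- congr (integral _ _ _); rewrite -itv_bndbnd_setU// bnd_simp//.
- apply: measurable_funS mg => // u /=; rewrite !in_itv/= !andbT.
  by move=> [/andP[xu _]|yu]; lra.
- by move=> u; rewrite /= !in_itv/= !andbT => -[/andP[xu _]|yu]; apply: g0; lra.
- apply/disj_setPLR => u /=; rewrite !in_itv/= andbT => /andP[_ uy].
  by apply/negP; rewrite -leNgt.
Qed.

Lemma tail_ge0 g x : nonneg_measurable g -> 0 <= x ->
  (0 <= tail_integral g x)%E.
Proof.
move=> [g0 _] x0; apply: integral_ge0 => u /=.
by rewrite in_itv/= andbT => xu; apply: g0; lra.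
Qed.

Lemma tail_nonincreasing g x y : nonneg_measurable g -> 0 <= x -> x <= y ->
  (tail_integral g y <= tail_integral g x)%E.
Proof.
move=> pg x0 xy; rewrite (tail_split pg x0 xy) leeDr//.
apply: integral_ge0 => u /=; rewrite in_itv/= => /andP[xu _].
by apply: pg.1; lra.
Qed.

(** Measurability comes from monotonicity of the tail. *)
Lemma nonneg_measurable_tail g :
  nonneg_measurable g -> nonneg_measurable (tail_integral g).
Proof.
move=> pg; split=> [x|]; first exact: tail_ge0.
apply: nonincreasing_emeasurable; first exact: interval_is_interval.
by move=> x y /=; rewrite !in_itv/= !andbT => x0 _; exact: tail_nonincreasing.
Qed.

(** On ]x, x + t], of length t, g lies between the constants g (x + t) and g x. The bounds are
    stated as sums because a difference of tails could be infinity minus infinity. *)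
Lemma tail_increment_bounds g x0 x t : nonneg_measurable g -> 0 <= x0 ->
  (forall x y, x0 <= x -> x <= y -> (g y <= g x)%E) -> x0 <= x -> 0 < t ->
  (t%:E * g (x + t)%R + tail_integral g (x + t)%R <= tail_integral g x
    <= t%:E * g x + tail_integral g (x + t)%R)%E.
Proof.
move=> pg x00 gni x0x t0.
have mgx : measurable_fun (`]x, x + t]%classic : set R) g.
  apply: measurable_funS pg.2 => // u /=; rewrite !in_itv/= andbT.
  by move=> /andP[xu _]; lra.
have gpos u : x <= u -> (0 <= g u)%E by move=> xu; apply: pg.1; lra.
have cstE (r : \bar R) : (\int[mu]_(u in `]x, (x + t)%R]) cst r u = t%:E * r)%E.
  rewrite integral_cst//= lebesgue_measure_itv/= lte_fin ltrDl t0.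
  by rewrite -EFinB addrAC subrr add0r muleC.
rewrite (@tail_split g x (x + t)) ?lerDl//; [|lra|lra].
apply/andP; split; apply: leeD2r; rewrite -cstE;
  apply: ge0_le_integral => //= u;
  rewrite in_itv/= => /andP[xu ut];
  by first [apply: gpos; lra | apply: gni; lra].
Qed.

(** Convergence to a finite limit forces the tail, and then g, to be finite near infinity; the
    real-valued argument then applies to the finite parts. *)
Lemma tail_cvg_density g x0 (h : R -> R) (alpha c : R) :
  nonneg_measurable g -> 0 <= x0 ->
  (forall x y, x0 <= x -> x <= y -> (g y <= g x)%E) ->
  (\forall x \near +oo, 0 < h x) ->
  (forall t, h (x + t) / h x @[x --> +oo] --> expR (- alpha * t)) ->
  (tail_integral g x * ((h x)^-1)%:E)%E @[x --> +oo] --> c%:E ->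
  (g x * ((h x)^-1)%:E)%E @[x --> +oo] --> (alpha * c)%:E.
Proof.
move=> pg x00 gni h0 hr /fine_cvgP[Tfin Tcvg].
have {}Tfin : \forall x \near +oo, tail_integral g x \is a fin_num.
  near=> x.
  have hx : 0 < h x by near: x.
  have : (tail_integral g x * ((h x)^-1)%:E)%E \is a fin_num by near: x.
  have : (0 <= tail_integral g x)%E.
    by apply: tail_ge0 => //; near: x; exact: nbhs_pinfty_ge (num_real _).
  (* An infinite tail times the positive number (h x)^-1 would be infinite. *)
  by case: (tail_integral g x) => // _; rewrite gt0_mulye// lte_fin invr_gt0.
have inc : \forall x \near +oo, forall t, 0 < t ->
  (t%:E * g (x + t)%R + tail_integral g (x + t)%R <= tail_integral g x
    <= t%:E * g x + tail_integral g (x + t)%R)%E.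
  near=> x.
  have x0x : x0 <= x by near: x; exact: nbhs_pinfty_ge (num_real _).
  by move=> t t0; exact: (tail_increment_bounds pg x00 gni x0x t0).
have gfin : \forall x \near +oo, g x \is a fin_num.
  near=> x.
  have g0 : (0 <= g x)%E.
    by apply: pg.1; near: x; exact: nbhs_pinfty_ge (num_real _).
  have Tx : tail_integral g x \is a fin_num by near: x.
  have Tx1 : tail_integral g (x - 1) \is a fin_num.
    by near: x; exact: (@cvg_addr_pinfty R (-1) _ Tfin).
  (* The lower bound at x - 1 with t = 1 gives g x + T x <= T (x - 1), where T is the tail integral,
     with both tails finite. *)
  have : (1%:E * g (x - 1 + 1)%R + tail_integral g (x - 1 + 1)%R
    <= tail_integral g (x - 1)%R)%E.
    suff : forall t, 0 < t ->
        (t%:E * g (x - 1 + t)%R + tail_integral g (x - 1 + t)%R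
          <= tail_integral g (x - 1)%R
          <= t%:E * g (x - 1)%R + tail_integral g (x - 1 + t)%R)%E.
      by move=> /(_ 1 ltr01)/andP[].
    by near: x; exact: (@cvg_addr_pinfty R (-1) _ inc).
  rewrite subrK mul1e -(fineK Tx) -(fineK Tx1).
  by case: (g x) g0.
have gcvg : fine (g x) / h x @[x --> +oo] --> alpha * c.
  apply: (@cvg_monotone_density R (fine \o tail_integral g) _ h) => //.
    (* Explicit thresholds make finiteness available at x + t for all t > 0 at once, since t is
       introduced after x. *)
    have [M [_ HM]] := Tfin; have [N [_ HN]] := gfin.
    near=> x.
    have Mx : M < x by near: x; exact: nbhs_pinfty_gt (num_real _).
    have Nx : N < x by near: x; exact: nbhs_pinfty_gt (num_real _).
    have xinc : forall t, 0 < t ->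
      (t%:E * g (x + t)%R + tail_integral g (x + t)%R <= tail_integral g x
      <= t%:E * g x + tail_integral g (x + t)%R)%E by near: x.
    move=> t t0; have := xinc t t0.
    have Mxt : M < x + t by lra.
    have Nxt : N < x + t by lra.
    rewrite /= -(fineK (HM _ Mx)) -(fineK (HM _ Mxt)) -(fineK (HN _ Nx)).
    rewrite -(fineK (HN _ Nxt)) -!EFinM -!EFinD !lee_fin /=.
    by move=> /andP[? ?]; apply/andP; split; lra.
  apply: cvg_trans Tcvg; apply: near_eq_cvg; near=> x => /=.
  by rewrite fineM//; near: x.
apply/fine_cvgP; split; first by near=> x; rewrite fin_numM//; near: x.
apply: cvg_trans gcvg; apply: near_eq_cvg; near=> x => /=.
by rewrite fineM//; near: x.
Unshelve. all: by end_near. Qed.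

(** * Descent along the iterated tails *)

Lemma nonneg_measurable_iter_tail n (f : R -> R) :
  nonneg_measurable (EFin \o f) -> nonneg_measurable (iter_tail n f).
Proof. by move=> pf; elim: n => // n; exact: nonneg_measurable_tail. Qed.

(** Each function reached is itself a tail integral, hence nonincreasing from 0 on, and each descent
    multiplies the limit by alpha. It stops at T f because f is not assumed monotone here. *)
Lemma iter_tail_cvg_descent n (f h : R -> R) (alpha c : R) :
  nonneg_measurable (EFin \o f) ->
  (\forall x \near +oo, 0 < h x) ->
  (forall t, h (x + t) / h x @[x --> +oo] --> expR (- alpha * t)) ->
  (iter_tail n.+1 f x * ((h x)^-1)%:E)%E @[x --> +oo] --> c%:E ->
  (iter_tail 1 f x * ((h x)^-1)%:E)%E @[x --> +oo] --> (alpha ^+ n * c)%:E.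
Proof.
move=> pf h0 hr; elim: n c => [|n IHn] c Tc; first by rewrite expr0 mul1r.
have pg := nonneg_measurable_iter_tail n.+1 pf.
rewrite exprSr -mulrA; apply: IHn.
exact: (tail_cvg_density pg (lexx 0)
  (fun x y => @tail_nonincreasing _ x y (nonneg_measurable_iter_tail n pf))
  h0 hr Tc).
Qed.

(** For c != 0 the quotients by c h and by h differ by a constant invertible factor; the case c = 0
    is the definition. Both cases thus become one limit statement. *)
Lemma asymp_equiv_scaleP (F : R -> \bar R) (c : R) (h : R -> R) :
  asymp_equiv_scale F c h <-> (F x * ((h x)^-1)%:E)%E @[x --> +oo] --> c%:E.
Proof.
rewrite /asymp_equiv_scale; have [->//|c0] := eqVneq c 0; rewrite /asymp_equiv.
have scaleE x : (F x * ((c * h x)^-1)%:E = (c^-1)%:E * (F x * ((h x)^-1)%:E))%E.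
  by rewrite invfM EFinM muleCA.
under eq_fun do rewrite scaleE.
split=> [|] Fc.
  rewrite -[c]mulr1 EFinM.
  have := @cvgeZl _ _ _ _ _ c%:E erefl Fc.
  under eq_fun do rewrite muleA -EFinM divff// mul1e.
  exact.
by rewrite -(mulVf c0) EFinM; exact: cvgeZl.
Qed.
End tail_integral.

Theorem lemma6p1 (R : realType) (f : R -> R)
    (f_ge0 : forall x : R, 0 <= x -> 0 <= f x)
    (f_int : (@lebesgue_measure R).-integrable `[0, +oo[ (EFin \o f))
    (n : nat) (n_ge1 : (1 <= n)%N)
    (kappa b alpha : R) (b_gt0 : 0 < b) (alpha_ge0 : 0 <= alpha)
    (Tnf : asymp_equiv (iter_tail n f)
             (fun x => b * x `^ kappa * expR (- alpha * x))) :
  (ultimately_nonincreasing f ->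
     asymp_equiv_scale (EFin \o f) (alpha ^+ n * b)
       (fun x => x `^ kappa * expR (- alpha * x)))
  /\ asymp_equiv_scale (iter_tail 1 f) (alpha ^+ n.-1 * b)
       (fun x => x `^ kappa * expR (- alpha * x)).
Proof.
(* With n.+1 in place of n, the exponent of alpha in the second claim becomes n, the number of
   descents from T^(n+1) f to T f. *)
case: n n_ge1 Tnf => // n _ Tnf.
have pf : nonneg_measurable (EFin \o f).
  split; first by move=> x x0; rewrite lee_fin f_ge0.
  by case/integrableP: f_int.
set h := fun x : R => x `^ kappa * expR (- alpha * x).
have h0 : \forall x \near +oo, 0 < h x.
  near=> x.
  have x0 : 0 < x by near: x; exact: nbhs_pinfty_gt (num_real _).
  by rewrite mulr_gt0 ?expR_gt0 ?powR_gt0.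
have hr t : h (x + t) / h x @[x --> +oo] --> expR (- alpha * t).
  exact: cvg_shift_ratio.
have {}Tnf : (iter_tail n.+1 f x * ((h x)^-1)%:E)%E @[x --> +oo] --> b%:E.
  apply/asymp_equiv_scaleP; rewrite /asymp_equiv_scale gt_eqF//.
  by under eq_fun do rewrite mulrA.
have T1f := iter_tail_cvg_descent pf h0 hr Tnf.
split; last exact/asymp_equiv_scaleP.
move=> [x0 x00 fni]; apply/asymp_equiv_scaleP.
(* One more descent, from T f to f, uses the monotonicity of f beyond x0 and supplies the last
   factor alpha. *)
rewrite exprS -mulrA; apply: (tail_cvg_density pf x00 _ h0 hr T1f) => x y.
by rewrite lee_fin; exact: fni.
Unshelve. all: by end_near. Qed.
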